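(* Let $B$ be an $m$-dimensional standard Brownian motion on any probability space, let $K_{ij}$ ($1\le i\le d$, $1\le j\le m$) be admissible Volterra kernels satisfying Assumption F, let $x\in\mathbb R^d$, and let $\widehat B^{(\varepsilon)}=(\widehat B^{1,(\varepsilon)},\dots,\widehat B^{d,(\varepsilon)})$ be given by $$\widehat B^{i,(\varepsilon)}_t=x_i+\sqrt\varepsilon\sum_{j=1}^m\int_0^tK_{ij}(t,s)dB^{(j)}_s,\quad t\in[0,T],\ 1\le i\le d.$$ Then for every $\beta>0$ there exists $\varepsilon_1\in(0,1]$ depending only on $\beta$ such that for all $0<\varepsilon<\varepsilon_1$ $$\mathbb E\left[\exp\left\{\beta\int_0^T\|\widehat B^{(\varepsilon)}_s\|_d^2ds\right\}\right]\le L,$$ where $L>0$ is a constant independent of $\varepsilon$.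
   Context: $T>0$, $\|\cdot\|_d$ is the Euclidean norm. A real function $K$ on $[0,T]^2$ is an admissible Volterra kernel if it is Borel measurable, Lebesgue square-integrable over $[0,T]^2$, for every $t\in(0,T]$ the slice $s\mapsto K(t,s)$ belongs to $L^2[0,T]$ and is not almost everywhere zero, and $K(t,s)=0$ for $s>t$. *Assumption F* for $K$: there is a modulus of continuity $\eta$ (nonnegative, nondecreasing, $\eta(s)\to0$ as $s\to0$) with $\int_{b}^\infty\eta(u^{-1})(\log u)^{-1/2}\frac{du}{u}<\infty$ for some $b>1$ and $$\sup_{t,s\in[0,T],\,|t-s|\le\tau}\int_0^T(K(t,u)-K(s,u))^2du\le\eta^2(\tau),\quad\tau\in[0,T].$$ The kernels and $x$ (the model) are fixed; ''depending only on $\beta$'' is meant for the given model. *)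

(* Defs.v *)
From HB Require Import structures.
From mathcomp Require Export all_boot all_order all_algebra.
From mathcomp Require Export all_classical all_reals all_analysis.
From mathcomp Require Export measurable_realfun.
Export numFieldNormedType.Exports.
Export Order.TTheory GRing.Theory Num.Theory.

Set Implicit Arguments.
Unset Strict Implicit.
Unset Printing Implicit Defensive.

Local Open Scope classical_set_scope.
Local Open Scope ring_scope.

Definition enorm (R : realType) (n : nat) (v : 'rV[R]_n) : R :=
  Num.sqrt (\sum_(i < n) v ord0 i ^+ 2).

(* For functions that are only meaningful on D, which rules out the library's
   Lfun mu 2%:E (it constrains f on the whole type). *)
Definition square_integrable (dp : measure_display) (S : measurableType dp)
    (R : realType) (mu : set S -> \bar R) (D : set S) (f : S -> R) : Prop :=
  measurable_fun D f /\ (\int[mu]_(x in D) (f x ^+ 2)%:E < +oo)%E.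

Section volterra_kernels.
Context {R : realType}.
Notation mu := (@lebesgue_measure R).

Definition admissible_kernel (T : R) (K : R -> R -> R) : Prop :=
  [/\ square_integrable (mu \x mu)%E (`[0, T] `*` `[0, T])
        (fun p : measurableTypeR R * measurableTypeR R => K p.1 p.2),
      forall t, 0 < t <= T -> square_integrable mu `[0, T] (K t),
      forall t, 0 < t <= T ->
        ~ {ae mu, forall s, `[0, T]%classic s -> K t s = 0} &
      forall t s, 0 <= t <= T -> 0 <= s <= T -> t < s -> K t s = 0].

Definition modulus_of_continuity (eta : R -> R) : Prop :=
  [/\ forall s, 0 <= s -> 0 <= eta s,
      forall s t, 0 <= s -> s <= t -> eta s <= eta t &
      eta s @[s --> 0^'+] --> 0].

Definition assumptionF (T : R) (K : R -> R -> R) : Prop :=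
  exists eta : R -> R,
  [/\ modulus_of_continuity eta,
      exists2 b : R, 1 < b &
        (\int[mu]_(u in `]b, +oo[)
           (eta u^-1 * (ln u `^ (- 2^-1)) / u)%:E < +oo)%E &
      forall tau, 0 <= tau <= T ->
        (ereal_sup [set y | exists t s : R,
            [/\ (0 <= t <= T)%R, (0 <= s <= T)%R, (`|t - s| <= tau)%R &
              y = \int[mu]_(u in `[0%R, T]) ((K t u - K s u) ^+ 2)%:E]]
         <= (eta tau ^+ 2)%:E)%E].

End volterra_kernels.

Section brownian_motion.
Context {R : realType} {dp : measure_display} {Omega : measurableType dp}.
Variable P : probability Omega R.

Definition independent_events (I : finType) (F : I -> set (set Omega)) : Prop :=
  forall (J : {set I}) (E : I -> set Omega),
    (forall i, i \in J -> F i (E i)) ->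
    P (\bigcap_(i in [set` J]) E i) = (\prod_(i in J) P (E i))%E.

Definition sigma_rv (X : Omega -> R) : set (set Omega) :=
  preimage_set_system setT X measurable.

Definition sigma_process (T : R) (W : R -> Omega -> R) : set (set Omega) :=
  <<s [set E | exists2 t, 0 <= t <= T & sigma_rv (W t) E] >>.

(* normal_prob takes the mean and the standard deviation. *)
Definition brownian_motion (T : R) (W : R -> Omega -> R) : Prop :=
  [/\ forall t, 0 <= t <= T -> measurable_fun setT (W t),
      {ae P, forall w, W 0 w = 0},
      forall (n : nat) (t : nat -> R),
        0 <= t 0%N -> t n <= T -> (forall k, (k < n)%N -> t k <= t k.+1) ->
        independent_events
          (fun k : 'I_n => sigma_rv (fun w => W (t k.+1) w - W (t k) w)),
      forall s t, 0 <= s -> s < t -> t <= T ->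
        forall A : set (measurableTypeR R), measurable A ->
        P [set w | A (W t w - W s w)] = normal_prob 0 (Num.sqrt (t - s)) A &
      {ae P, forall w, {within `[0, T], continuous (fun t => W t w)}}].

Definition multi_brownian_motion (T : R) (m : nat)
    (B : 'I_m -> R -> Omega -> R) : Prop :=
  (forall j, brownian_motion T (B j)) /\
  independent_events (fun j => sigma_process T (B j)).

(* The list of (c, (a, b)) encodes the step function \sum c * 1_(a, b]; the
   intervals may overlap, which affects neither the function nor its integral. *)
Definition step_fun (g : seq (R * (R * R))) (s : R) : R :=
  \sum_(e <- g) e.1 * ((e.2.1 < s <= e.2.2)%R)%:R.

Definition step_integral (W : R -> Omega -> R) (g : seq (R * (R * R)))
    (w : Omega) : R :=
  \sum_(e <- g) e.1 * (W e.2.2 w - W e.2.1 w).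

Definition steps_in (t : R) (g : seq (R * (R * R))) : bool :=
  all (fun e => (0 <= e.2.1) && (e.2.1 <= e.2.2 <= t)) g.

(* X is a version of the Wiener integral of f against W over [0, t]: the L^2(P)
   limit of the elementary integrals of step functions converging to f in
   L^2[0, t]. By the Ito isometry the limit does not depend on the
   approximating sequence, up to P-null sets. *)
Definition wiener_integral (W : R -> Omega -> R) (t : R) (f : R -> R)
    (X : Omega -> R) : Prop :=
  measurable_fun setT X /\
  exists g : nat -> seq (R * (R * R)),
  [/\ forall n, steps_in t (g n),
      (\int[@lebesgue_measure R]_(s in `[0%R, t])
         ((f s - step_fun (g n) s) ^+ 2)%:E)%E @[n --> \oo] --> 0%E &
      (\int[P]_w ((X w - step_integral W (g n) w) ^+ 2)%:E)%E
         @[n --> \oo] --> 0%E].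

(* The stochastic integrals determine Y t only up to a P-null set depending on
   t, so the process is required to be jointly measurable, as is needed for its
   pathwise time integrals to be random variables; the continuous version is
   of this kind. *)
Definition gaussian_model (T : R) (d m : nat)
    (K : 'I_d -> 'I_m -> R -> R -> R) (x : 'rV[R]_d)
    (B : 'I_m -> R -> Omega -> R) (eps : R) (Y : R -> Omega -> 'rV[R]_d)
    : Prop :=
  (forall i, measurable_fun (`[0, T] `*` setT)
     (fun p : measurableTypeR R * Omega => Y p.1 p.2 ord0 i)) /\
  (forall (t : R) (i : 'I_d), 0 <= t <= T ->
     exists X : 'I_m -> Omega -> R,
       (forall j, wiener_integral (B j) t (K i j t) (X j)) /\
       {ae P, forall w,
          Y t w ord0 i = x ord0 i + Num.sqrt eps * \sum_(j < m) X j w}).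

End brownian_motion.

(* Main.v *)
(* By Jensen in time and Tonelli it suffices to bound E exp(a |Y_t|^2) uniformly
   in t.  Y_t is x plus sqrt(eps) times a sum of Wiener integrals, whose variances
   are bounded uniformly in t by Assumption F (compare K(t, .) with K(0, .) = 0).
   Since exp(sum of the d m terms) <= sum of exp(d m times one term), the claim
   reduces to bounding E exp(lam X^2) for a single Wiener integral X and a small
   lam.  For a step integrand, rewritten over a common partition of the end points,
   the integral S is a linear combination of independent normal increments, and
   E exp(lam S^2) = E exp(Z S) with Z ~ N(0, 2 lam) independent of S.  The bound
   passes to the L^2 limit X of such S through
   min(exp(lam X^2), N) <= e exp(2 lam S^2) + N (X - S)^2. *)
Require Import Defs.
From mathcomp Require Import all_boot all_order all_algebra.
From mathcomp Require Import all_classical all_reals all_analysis.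
From mathcomp Require Import ring lra.

Import Order.TTheory GRing.Theory Num.Theory.

Local Open Scope classical_set_scope.
Local Open Scope ring_scope.

(** * Comparison and extension of integrals of nonnegative functions *)

(** The integral of a nonnegative function is a supremum over simple functions below it, so the
    comparison holds without measurability; it is meant for the exponential of a pathwise time
    integral. *)
Lemma ge0_le_integral_setT d (S : measurableType d) (R : realType)
    (m : {measure set S -> \bar R}) (f g : S -> \bar R) :
  (forall x, 0 <= f x)%E -> (forall x, f x <= g x)%E ->
  (\int[m]_x f x <= \int[m]_x g x)%E.
Proof.
move=> f0 fg; have g0 x : (0 <= g x)%E by exact: le_trans (fg x).
rewrite !ge0_integralTE//; apply: ereal_sup_le => _ [h hf <-].
by exists h => // x; exact: le_trans (fg x).
Qed.

Section integral_extension.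
Context d1 d2 (S : measurableType d1) (T : measurableType d2) (R : realType).
Variables (m : {measure set S -> \bar R}) (nu : {measure set T -> \bar R}).
Import HBNNSimple.

(** The usual passage from indicators to simple functions and, by monotone convergence, to [f]. It
    serves for densities ([X] the identity), for laws ([G] equal to 1) and for independence ([G] the
    product of the other factors). *)
Lemma ge0_integral_extend (G : S -> R) (X : S -> T) (c : R) :
  measurable_fun setT G -> (forall x, 0 <= G x) -> measurable_fun setT X ->
  (forall A, measurable A ->
    (\int[m]_x (G x * \1_A (X x))%:E = c%:E * nu A)%E) ->
  forall f : T -> R, measurable_fun setT f -> (forall y, 0 <= f y) ->
  (\int[m]_x (G x * f (X x))%:E = c%:E * \int[nu]_y (f y)%:E)%E.
Proof.
move=> mG G0 mX GX f mf f0.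
have mfE : measurable_fun setT (EFin \o f) by exact/measurable_EFinP.
pose h := nnsfun_approx measurableT mfE.
have hf y : (h n y)%:E @[n --> \oo] --> (f y)%:E.
  by apply: cvg_nnsfun_approx => // z _; rewrite lee_fin.
have ndh y a b : (a <= b)%N -> h a y <= h b y.
  by move=> ab; exact/lefP/nd_nnsfun_approx.
have mhX n : measurable_fun setT (fun x => h n (X x)).
  exact: measurableT_comp.
have L : (\int[m]_x (G x * h n (X x))%:E @[n --> \oo] -->
    \int[m]_x (G x * f (X x))%:E)%E.
  pose g' n x := (G x * h n (X x))%:E.
  rewrite (_ : (fun n => _) = fun n => (\int[m]_(x in setT) g' n x)%E)//.
  have -> : (\int[m]_x (G x * f (X x))%:E =
      \int[m]_x (limn (g' ^~ x)))%E.
    apply: eq_integral => x _; apply/esym/cvg_lim => //.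
    rewrite /g'; under eq_fun do rewrite EFinM.
    by rewrite EFinM; apply: cvgeZl => //; exact: hf.
  apply: cvg_monotone_convergence => //.
  - by move=> n; apply/measurable_EFinP/measurable_funM.
  - by move=> n x _; rewrite lee_fin mulr_ge0.
  - by move=> x _ a b ab; rewrite lee_fin ler_wpM2l// ndh.
have Rr : (c%:E * \int[nu]_y (h n y)%:E @[n --> \oo] -->
    c%:E * \int[nu]_y (f y)%:E)%E.
  apply: cvgeZl => //.
  have -> : (\int[nu]_y (f y)%:E =
      \int[nu]_y (limn (fun n => (h n y)%:E)))%E.
    by apply: eq_integral => x _; apply/esym/cvg_lim => //; exact: hf.
  apply: cvg_monotone_convergence => //.
  - by move=> n; exact/measurable_EFinP.
  - by move=> n x _; rewrite lee_fin.
  - by move=> x _ a b ab; rewrite lee_fin ndh.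
(* Both sides are limits along the simple functions [h n], so it is enough to compare them for each
   [n]. *)
apply: (cvg_unique _ L) => //.
suff -> : (fun n => \int[m]_x (G x * h n (X x))%:E)%E =
  (fun n => c%:E * \int[nu]_y (h n y)%:E)%E by [].
apply/funext => n.
have mI r : measurable (h n @^-1` [set r]).
  by rewrite -[X in measurable X]setTI; exact: measurable_funP.
have m1X r : measurable_fun setT (fun x => \1_(h n @^-1` [set r]) (X x) : R).
  by apply: measurableT_comp => //; exact: measurable_indic.
have mGI r : measurable_fun setT (fun x => (G x * \1_(h n @^-1` [set r]) (X x))%:E).
  by apply/measurable_EFinP; apply: measurable_funM.
under eq_integral => x _.
  rewrite fimfunE EFinM -fsumEFin// ge0_mule_fsumr; last first.
    by move=> r; exact: nnfun_muleindic_ge0.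
  over.
rewrite /= ge0_integral_fsum//; last 2 first.
- move=> r; under eq_fun do rewrite -EFinM mulrCA EFinM.
  exact: measurable_funeM.
- by move=> r x _; apply: mule_ge0; [rewrite lee_fin|
    rewrite EFinM nnfun_muleindic_ge0].
under [in RHS]eq_integral => x _ do rewrite fimfunE -fsumEFin//.
rewrite ge0_integral_fsum//; last 2 first.
- by move=> r; apply/measurable_EFinP/measurable_funM => //;
    exact: measurable_indic.
- by move=> r x _; rewrite EFinM nnfun_muleindic_ge0.
rewrite ge0_mule_fsumr; last first.
  by move=> r; apply: integral_ge0 => x _; rewrite EFinM nnfun_muleindic_ge0.
apply: eq_fsbigr => r; rewrite inE => -[y _ <-{r}].
under eq_integral => x _ do rewrite -EFinM mulrCA EFinM.
rewrite ge0_integralZl//; last 2 first.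
- by move=> x _; rewrite lee_fin mulr_ge0.
- by rewrite lee_fin.
rewrite integralZl_indic_nnsfun//.
rewrite integral_indic// setIT.
rewrite GX//.
by rewrite muleCA.
Qed.
End integral_extension.

(** * Exponential moments of centred normal laws *)

Section gaussian_exponentials.
Context {R : realType}.
Notation mu := (@lebesgue_measure R).

Lemma ge0_integral_normal_prob (m s : R) (f : R -> R) :
  measurable_fun setT f -> (forall x, 0 <= f x) ->
  (\int[normal_prob m s]_x (f x)%:E =
   \int[mu]_x (normal_pdf m s x * f x)%:E)%E.
Proof.
move=> mf f0; symmetry; rewrite -[RHS]mul1e.
apply: (@ge0_integral_extend _ _ _ _ _ _ _ _ id) => //.
- exact: measurable_normal_pdf.
- by move=> x; exact: normal_pdf_ge0.
- move=> A mA; rewrite mul1e.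
  transitivity (\int[mu]_(x in A) (normal_pdf m s x)%:E)%E => //.
  rewrite [in RHS]integral_mkcond.
  by apply: eq_integral => x _; rewrite epatch_indic/= EFinM.
Qed.

(** Completing the square: [expR (v * x)] times the density of mean 0 is the constant on the right
    times the density of mean [v * s ^+ 2]. *)
Lemma normal_mgf (s v : R) : s != 0 ->
  (\int[normal_prob 0 s]_x (expR (v * x))%:E = (expR (v ^+ 2 * s ^+ 2 / 2))%:E)%E.
Proof.
move=> s0; rewrite ge0_integral_normal_prob; last 2 first.
- by apply: measurableT_comp => //; exact: measurable_funM.
- by move=> x; exact: expR_ge0.
transitivity (\int[mu]_x ((expR (v ^+ 2 * s ^+ 2 / 2))%:E *
                          (normal_pdf (v * s ^+ 2) s x)%:E))%E.
  apply: eq_integral => x _; rewrite -EFinM; congr EFin.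
  rewrite !normal_pdfE// -[LHS]mulrA [RHS]mulrCA; congr *%R.
  rewrite /normal_fun -!expRD; congr expR.
  by rewrite subr0; field.
rewrite ge0_integralZl//.
- by rewrite integral_normal_pdf mule1.
- by apply/measurable_EFinP; exact: measurable_normal_pdf.
- by move=> x _; rewrite lee_fin normal_pdf_ge0.
Qed.

(** The bound on [V] leaves at least half of the Gaussian decay, so the integrand times the density
    is at most [Num.sqrt 2] times the centred normal density of variance [2 * s ^+ 2]. *)
Lemma normal_exp_sqr_le (s V : R) : s != 0 -> s ^+ 2 * V <= 2^-1 ->
  (\int[normal_prob 0 s]_x (expR (x ^+ 2 * V / 2))%:E <= (Num.sqrt 2)%:E)%E.
Proof.
move=> s0 sV.
have s20 : 0 < s ^+ 2 by rewrite exprn_even_gt0.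
have mf : measurable_fun setT (fun x : R => expR (x ^+ 2 * V / 2)).
  apply: measurableT_comp => //; apply: measurable_funM => //.
  by apply: measurable_funM => //; exact: measurable_funX.
rewrite ge0_integral_normal_prob//.
pose s' : R := Num.sqrt 2 * s.
have s'2 : s' ^+ 2 = 2 * s ^+ 2 by rewrite exprMn sqr_sqrtr.
have s'0 : s' != 0 by rewrite mulf_neq0// sqrtr_eq0 -ltNge.
have Hpk : normal_peak s = Num.sqrt 2 * normal_peak s'.
  rewrite /normal_peak s'2.
  have -> : 2 * s ^+ 2 * pi *+ 2 = 2 * (s ^+ 2 * pi *+ 2) by ring.
  rewrite sqrtrM// invfM mulrA divff ?mul1r//.
apply: (@le_trans _ _ (\int[mu]_x ((Num.sqrt 2)%:E * (normal_pdf 0 s' x)%:E))%E).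
  apply: ge0_le_integral => //.
  - by move=> x _; rewrite lee_fin mulr_ge0// ?normal_pdf_ge0 ?expR_ge0.
  - apply/measurable_EFinP/measurable_funM => //; exact: measurable_normal_pdf.
  - apply: measurable_funeM; apply/measurable_EFinP; exact: measurable_normal_pdf.
  - move=> x _; rewrite -EFinM lee_fin !normal_pdfE// mulrA -Hpk -[leLHS]mulrA.
    rewrite ler_wpM2l ?normal_peak_ge0// /normal_fun -expRD ler_expR subr0 s'2.
    rewrite -subr_ge0.
    have -> : - x ^+ 2 / (2 * s ^+ 2 *+ 2) - (- x ^+ 2 / (s ^+ 2 *+ 2) +
        x ^+ 2 * V / 2)
      = (x ^+ 2 / s ^+ 2 / 2) * (2^-1 - s ^+ 2 * V) by field.
    apply: mulr_ge0; last by rewrite subr_ge0.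
    by rewrite !divr_ge0// sqr_ge0.
rewrite ge0_integralZl//.
- by rewrite integral_normal_pdf mule1.
- by apply/measurable_EFinP; exact: measurable_normal_pdf.
- by move=> x _; rewrite lee_fin normal_pdf_ge0.
Qed.

End gaussian_exponentials.

(** * Expectations of products of independent variables *)

Section independence.
Context {R : realType} {dp : measure_display} {Omega : measurableType dp}.
Variable P : probability Omega R.

(** Induction on the number [j] of leading factors that are arbitrary, the others being indicators;
    for [j = 0] the product is the indicator of an intersection and independence applies. *)
Lemma integral_prod_independent (n : nat) (X : 'I_n -> Omega -> R)
    (F : 'I_n -> R -> R) (e : 'I_n -> R) :
  (forall k, measurable_fun setT (X k)) ->
  independent_events P (fun k => sigma_rv (X k)) ->
  (forall k, measurable_fun setT (F k)) -> (forall k x, 0 <= F k x) ->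
  (forall k, \int[P]_w (F k (X k w))%:E = (e k)%:E)%E ->
  (\int[P]_w (\prod_(k < n) F k (X k w))%:E = (\prod_(k < n) e k)%:E)%E.
Proof.
move=> mX indep.
suff H : forall j, (j <= n)%N -> forall (F : 'I_n -> R -> R) (e : 'I_n -> R),
  (forall k, measurable_fun setT (F k)) -> (forall k x, 0 <= F k x) ->
  (forall k, \int[P]_w (F k (X k w))%:E = (e k)%:E)%E ->
  (forall k : 'I_n, (j <= k)%N ->
     exists2 A : set R, measurable A & F k = \1_A) ->
  (\int[P]_w (\prod_(k < n) F k (X k w))%:E = (\prod_(k < n) e k)%:E)%E.
  move=> mF F0 Fe; apply: (H n (leqnn n)) => // k.
  by rewrite leqNgt ltn_ord.
elim=> [_|j IH jn] {}F {}e mF F0 Fe FI.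
  have /choice[A AP] : forall k : 'I_n, exists A : set R,
      measurable A /\ F k = \1_A.
    by move=> k; have [A mA FA] := FI k isT; exists A.
  pose E k := X k @^-1` A k.
  have mE k : measurable (E k).
    by rewrite /E -[X in measurable X]setTI; apply: mX => //; case: (AP k).
  have eE k : (e k)%:E = P (E k).
    rewrite -Fe (AP k).2 -[in RHS](setIT (E k)) -integral_indic//.
  transitivity (\int[P]_w (\1_(\bigcap_(i in [set` [set: 'I_n]%SET]) E i) w)%:E)%E.
    apply: eq_integral => w _; congr EFin.
    rewrite indicE; case: (boolP (w \in _)); rewrite ?inE ?notin_setE => Hw.
      rewrite big1// => k _; rewrite (AP k).2 indicE mem_set//.
      by apply: Hw => /=; rewrite inE.
    have [k Hk] : exists k, ~ E k w.
      by apply: contra_notP Hw => /forallNP Hw k _; apply: contrapT; exact: Hw.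
    by rewrite (bigD1 k)//= (AP k).2 indicE memNset// mul0r.
  rewrite integral_indic//; last exact: fin_bigcap_measurable.
  rewrite setIT.
  transitivity (\prod_(k in [set: 'I_n]%SET) P (E k))%E.
    apply: indep => k _; exists (A k); [by case: (AP k)|by rewrite setTI].
  rewrite -prodEFin/=; apply: eq_big => k; first by rewrite inE.
  by rewrite -eE.
pose j' := Ordinal jn.
pose G w := \prod_(k < n | k != j') F k (X k w).
have mFX k : measurable_fun setT (fun w => F k (X k w)).
  exact: measurableT_comp.
have FG w : \prod_(k < n) F k (X k w) = G w * F j' (X j' w).
  by rewrite (bigD1 j')//= mulrC.
have eG : \prod_(k < n) e k = \prod_(k < n | k != j') e k * e j'.
  by rewrite (bigD1 j')//= mulrC.
under eq_integral do rewrite FG.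
pose Xj : {mfun Omega >-> R} := mfun_Sub (mem_set (mX j')).
have c0 : 0 <= \prod_(k < n | k != j') e k.
  apply: prodr_ge0 => k _; rewrite -lee_fin -Fe.
  by apply: integral_ge0 => w _; rewrite lee_fin.
have mG : measurable_fun setT G.
  rewrite /G; under eq_fun do rewrite -big_filter.
  exact: measurable_prod.
rewrite eG EFinM -Fe.
transitivity ((\prod_(k < n | k != j') e k)%:E *
    \int[pushforward P Xj]_y (F j' y)%:E)%E; last first.
  by rewrite ge0_integral_pushforward//; [exact/measurable_EFinP|];
    move=> y _; rewrite lee_fin.
(* With the other factors fixed, the identity extends to [F j'] from indicators, for which it is the
   induction hypothesis. *)
apply: (@ge0_integral_extend _ _ _ _ _ _ _ G (X j')) => //.
  by move=> w; rewrite prodr_ge0.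
move=> A mA.
pose F' k := if k == j' then \1_A else F k.
pose e' k := if k == j' then fine (P (X j' @^-1` A)) else e k.
have mXA : measurable (X j' @^-1` A).
  by have := mX j' measurableT _ mA; rewrite setTI.
transitivity (\int[P]_w (\prod_(k < n) F' k (X k w))%:E)%E.
  apply: eq_integral => w _; congr EFin.
  rewrite [RHS](bigD1 j')//= /F' eqxx mulrC; congr (_ * _).
  by apply: eq_bigr => k /negbTE ->.
rewrite (IH (ltnW jn) F' e').
- rewrite (bigD1 j')//= /e' eqxx EFinM muleC fineK ?fin_num_measure//.
  by congr (_%:E * _)%E; apply: eq_bigr => k /negbTE ->.
- by move=> k; rewrite /F'; case: ifP => // _; exact: measurable_indic.
- by move=> k y; rewrite /F'; case: ifP.
- move=> k; rewrite /F' /e'; case: eqVneq => [->|//].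
  by rewrite fineK ?fin_num_measure// -[in RHS](setIT (_ @^-1` _)) -integral_indic.
- move=> k; rewrite /F' leq_eqVlt => /orP[/eqP jk|/FI//].
    by have -> : k = j'; [exact/val_inj|exists A; rewrite ?eqxx].
  by case: ifP => // _ ; exists A.
Qed.
End independence.

(** * Exponential moments of linear combinations of Brownian increments *)

Section brownian_exponentials.
Context {R : realType} {dp : measure_display} {Omega : measurableType dp}.
Variables (P : probability Omega R) (T : R) (W : R -> Omega -> R).
Hypothesis bmW : brownian_motion P T W.

Lemma brownian_increment_mgf (s t v : R) : 0 <= s -> s <= t -> t <= T ->
  (\int[P]_w (expR (v * (W t w - W s w)))%:E =
   (expR (v ^+ 2 * (t - s) / 2))%:E)%E.
Proof.
(* The law of an increment is given only for [s < t]; for [s = t] both sides are 1. *)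
move=> s0; rewrite le_eqVlt => /orP[/eqP <- tT|st tT].
  under eq_integral do rewrite subrr mulr0.
  by rewrite integral_cst// subrr mulr0 mul0r
    [X in (_ * X)%E]probability_setT mule1.
case: bmW => mW _ _ lawW _.
have ts0 : 0 < t - s by rewrite subr_gt0.
have sd0 : Num.sqrt (t - s) != 0 by rewrite gt_eqF// sqrtr_gt0.
have -> : t - s = Num.sqrt (t - s) ^+ 2 by rewrite sqr_sqrtr// ltW.
rewrite -(@normal_mgf _ (Num.sqrt (t - s)) v)//.
have mD : measurable_fun setT (fun w => W t w - W s w).
  by apply: measurable_funB; apply: mW; rewrite ?s0 ?tT ?(le_trans s0) ?ltW//
    (lt_le_trans st).
rewrite -[RHS]mul1e.
under eq_integral do rewrite -[expR _]mul1r.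
apply: (@ge0_integral_extend _ _ Omega (measurableTypeR R) R P
  (normal_prob 0 (Num.sqrt (t - s))) (cst 1) (fun w => W t w - W s w) 1 _ _ _ _
  (fun y => expR (v * y))) => //.
- move=> A mA.
  under eq_integral do rewrite mul1r.
  rewrite mul1e; transitivity (P [set w | A (W t w - W s w)]); last exact: lawW.
  rewrite -[X in P X]setIT -integral_indic//.
  by have := mD measurableT _ mA; rewrite setTI.
- by apply: measurableT_comp => //; exact: measurable_funM.
Qed.

Variables (n : nat) (t : nat -> R) (c : nat -> R).
Hypotheses (t0 : 0 <= t 0%N) (tT : t n <= T)
  (ndt : forall k, (k < n)%N -> t k <= t k.+1).

Let partition_itv k : (k <= n)%N -> 0 <= t k <= T.
Proof.
have tle i j : (i <= j)%N -> (j <= n)%N -> t i <= t j.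
  elim: j => [|j IH]; first by rewrite leqn0 => /eqP ->.
  rewrite leq_eqVlt => /orP[/eqP -> //|ij jn].
  by apply: le_trans (ndt _ jn); apply: IH => //; exact: ltnW.
by move=> kn; rewrite (le_trans t0) ?(le_trans _ tT)// tle.
Qed.

Let increment (k : 'I_n) w := W (t k.+1) w - W (t k) w.

Let measurable_increment k : measurable_fun setT (increment k).
Proof.
case: bmW => mW _ _ _ _.
by apply: measurable_funB; apply/mW/partition_itv => //; exact: ltnW.
Qed.

(** The exponential of the sum is a product of functions of the independent increments. *)
Lemma brownian_sum_mgf (z : R) :
  (\int[P]_w (expR (z * \sum_(k < n) c k * (W (t k.+1) w - W (t k) w)))%:E =
   (expR (z ^+ 2 * (\sum_(k < n) c k ^+ 2 * (t k.+1 - t k)) / 2))%:E)%E.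
Proof.
case: (bmW) => _ _ indW _ _.
transitivity (\int[P]_w (\prod_(k < n)
    expR (z * c k * (W (t k.+1) w - W (t k) w)))%:E)%E.
  apply: eq_integral => w _; rewrite mulr_sumr expR_sum; congr EFin.
  by apply: eq_bigr => k _; rewrite mulrA.
rewrite (@integral_prod_independent _ _ _ P n
  increment (fun k y => expR (z * c k * y))
  (fun k => expR ((z * c k) ^+ 2 * (t k.+1 - t k) / 2))).
- rewrite -expR_sum mulr_sumr mulr_suml; congr (expR _)%:E.
  by apply: eq_bigr => k _; rewrite exprMn !mulrA.
- exact: measurable_increment.
- exact: indW.
- by move=> k; apply: measurableT_comp => //; exact: measurable_funM.
- by move=> k x; exact: expR_ge0.
- move=> k; apply: brownian_increment_mgf.
  + by case/andP: (partition_itv _ (ltnW (ltn_ord k))).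
  + exact: ndt.
  + by case/andP: (partition_itv _ (ltn_ord k)).
Qed.

(* With [Z] a centred normal variable of variance [2 lam] independent of the sum
   [S], [expR (lam * S ^+ 2)] is the conditional expectation of [expR (S * Z)]. *)
Lemma brownian_sum_exp_sqr (lam : R) : 0 < lam ->
  4 * lam * (\sum_(k < n) c k ^+ 2 * (t k.+1 - t k)) <= 1 ->
  (\int[P]_w (expR (lam *
     (\sum_(k < n) c k * (W (t k.+1) w - W (t k) w)) ^+ 2))%:E
   <= (Num.sqrt 2)%:E)%E.
Proof.
move=> lam0; set V := \sum_(k < n) _ => lamV.
pose S w := \sum_(k < n) c k * (W (t k.+1) w - W (t k) w).
pose s := Num.sqrt (2 * lam).
have s2 : s ^+ 2 = 2 * lam by rewrite sqr_sqrtr// mulr_ge0// ltW.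
have s0 : s != 0 by rewrite gt_eqF// sqrtr_gt0 mulr_gt0.
have mS : measurable_fun setT S.
  apply: measurable_sum => k; apply: measurable_funM => //.
  exact: measurable_increment.
under eq_integral => w _.
  rewrite -/(S w) (_ : lam * S w ^+ 2 = S w ^+ 2 * s ^+ 2 / 2); last first.
    by rewrite s2; field.
  rewrite -normal_mgf//; over.
pose f (p : Omega * measurableTypeR R) := (expR (S p.1 * p.2))%:E.
(* After the exchange, the inner expectation for fixed [z] is the moment generating function of the
   sum. *)
rewrite (@fubini_tonelli _ _ Omega (measurableTypeR R) R P (normal_prob 0 s) f);
  last 2 first.
- apply/measurable_EFinP; apply: measurableT_comp => //.
  by apply: measurable_funM => //; exact: measurableT_comp.
- by move=> p; rewrite lee_fin expR_ge0.
rewrite /f /=.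
under eq_integral => z _.
  under eq_integral do rewrite mulrC.
  rewrite brownian_sum_mgf; over.
(* As [s ^+ 2 = 2 * lam], the requirement [s ^+ 2 * V <= 2^-1] is [4 * lam * V <= 1]. *)
apply: normal_exp_sqr_le => //.
rewrite s2 -/V; lra.
Qed.

End brownian_exponentials.

(** * Step functions over a common partition *)

Section step_functions.
Context {R : realType}.
Notation mu := (@lebesgue_measure R).

Lemma measurable_step_fun (g : seq (R * (R * R))) (D : set R) :
  measurable_fun D (step_fun g).
Proof.
apply: measurable_funTS; apply: measurable_sum => e; apply: measurable_funM => //.
rewrite (_ : (fun _ => _) = \1_(`]e.2.1, e.2.2]%classic)).
  exact: measurable_indic.
by apply/funext => s; rewrite indicE mem_setE in_itv.
Qed.

(** A telescoping sum stopped at [x]; the second hypothesis says that [x] is not interior to any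
    cell of the partition. *)
Lemma sum_increments_le (w : R -> R) (n : nat) (t : nat -> R) (x : R) :
  (forall k, (k < n)%N -> t k <= t k.+1) ->
  (forall k, (k < n)%N -> x < t k.+1 -> x <= t k) ->
  t 0%N <= x -> x <= t n ->
  \sum_(k < n) (t k.+1 <= x)%R%:R * (w (t k.+1) - w (t k)) = w x - w (t 0%N).
Proof.
move=> ndt gap t0x xtn.
suff H m : (m <= n)%N ->
  \sum_(k < m) (t k.+1 <= x)%R%:R * (w (t k.+1) - w (t k)) =
  w (Num.min (t m) x) - w (t 0%N) by rewrite H// min_r.
elim: m => [_|m IH mn]; first by rewrite big_ord0 min_l// subrr.
rewrite big_ord_recr/= IH ?(ltnW mn)//.
have [tx|xt] := leP (t m.+1) x.
  by rewrite mul1r min_l ?(le_trans (ndt _ mn))//; ring.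
by rewrite mul0r addr0 min_r// gap.
Qed.

(** The partition consists of all end points in [g], sorted, so that none is interior to a cell and
    [step_fun g] is constant on each cell. It is chosen before [W] and [w], hence common to all
    paths. *)
Lemma step_fun_partition (tau : R) (g : seq (R * (R * R))) : 0 <= tau ->
  steps_in tau g ->
  exists (n : nat) (t c : nat -> R),
  [/\ 0 <= t 0%N, t n <= tau, forall k, (k < n)%N -> t k <= t k.+1,
      forall k, (k < n)%N -> forall s, t k < s <= t k.+1 -> step_fun g s = c k &
      forall (dp : measure_display) (Omega : measurableType dp)
        (W : R -> Omega -> R) w, step_integral W g w =
        \sum_(k < n) c k * (W (t k.+1) w - W (t k) w)].
Proof.
move=> tau0 /allP gin.
(* Adding 0 keeps the list nonempty; repeated points only give empty cells. *)
pose l := sort <=%R (0 :: flatten [seq [:: e.2.1; e.2.2] | e <- g]).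
pose n := (size l).-1.
pose t k := nth 0 l k.
have sl : size l = n.+1.
  by rewrite /n /l size_sort.
have memt k : (k <= n)%N -> t k \in l by move=> kn; rewrite mem_nth// sl.
have lin x : x \in l -> 0 <= x <= tau.
  rewrite mem_sort inE => /orP[/eqP ->|]; first by rewrite lexx.
  move=> /flattenP[_ /mapP[e eg ->]].
  have /andP[e0 /andP[e12 e2]] := gin _ eg.
  by rewrite !inE => /orP[] /eqP ->; rewrite ?e0 ?e2 ?(le_trans e12)//
    ?(le_trans e0).
have tle i j : (i <= j)%N -> (j <= n)%N -> t i <= t j.
  move=> ij jn; apply: (sorted_leq_nth le_trans le_refl) => //.
  - exact: sort_le_sorted.
  - by rewrite inE sl ltnS (leq_trans ij).
  - by rewrite inE sl ltnS.
have gap x k : x \in l -> (k < n)%N -> x < t k.+1 -> x <= t k.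
  move=> xl kn; rewrite -(nth_index 0 xl) -/(t _) => H.
  have il : (index x l <= n)%N by rewrite -ltnS -sl index_mem.
  apply: (tle _ k); last exact: ltnW.
  by rewrite leqNgt; apply/negP => ki; move: H; rewrite ltNge tle.
have le0n x : x \in l -> t 0%N <= x <= t n.
  move=> xl; have il : (index x l <= n)%N by rewrite -ltnS -sl index_mem.
  by rewrite -(nth_index 0 xl) -/(t _) !tle.
have el e : e \in g -> e.2.1 \in l /\ e.2.2 \in l.
  move=> eg; split; rewrite mem_sort inE; apply/orP; right; apply/flattenP;
    (exists [:: e.2.1; e.2.2]; first exact: map_f); rewrite !inE eqxx ?orbT//.
(* Cells are closed on the right, so the value at the right end is the value on the cell. *)
exists n, t, (fun k => step_fun g (t k.+1)); split.
- by have /andP[] := lin _ (memt 0%N isT).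
- by have /andP[] := lin _ (memt n (leqnn n)).
- by move=> k kn; rewrite tle.
- move=> k kn s /andP[ts st]; apply: eq_big_seq => e eg.
  have [e1 e2] := el _ eg; congr (_ * _%:R).
  congr (nat_of_bool (_ && _)).
    apply/idP/idP => [es|/gap H]; first exact: lt_le_trans st.
    by apply: le_lt_trans ts; exact: H.
  apply/idP/idP => [es|H]; last exact: le_trans H.
  by rewrite leNgt; apply/negP => /gap H; have := H e2 kn;
    rewrite leNgt (lt_le_trans ts).
- move=> dp Omega W w; rewrite /step_integral /step_fun.
  under [RHS]eq_bigr do rewrite mulr_suml.
  rewrite exchange_big/=; apply: eq_big_seq => e eg.
  have [e1 e2] := el _ eg.
  have /andP[_ /andP[e12 _]] := gin _ eg.
  under eq_bigr do rewrite -mulrA.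
  rewrite -mulr_sumr; congr (_ * _).
  have HS x : x \in l ->
      \sum_(k < n) (t k.+1 <= x)%R%:R * (W (t k.+1) w - W (t k) w)
      = W x w - W (t 0%N) w.
    move=> xl; have /andP[? ?] := le0n _ xl.
    apply: (sum_increments_le (W ^~ w)) => //.
      by move=> k kn; rewrite tle.
    by move=> k kn; exact: gap.
  (* An increment is the difference of two sums stopped at its end points; the coefficients that
     survive are those of the cells inside the interval. *)
  transitivity ((W e.2.2 w - W (t 0%N) w) - (W e.2.1 w - W (t 0%N) w)).
    by rewrite opprB addrA subrK.
  rewrite -!HS// -sumrB; apply: eq_bigr => k _; rewrite -mulrBl; congr (_ * _).
  have [H1|H1] := leP (t k.+1) e.2.1.
    by rewrite (le_trans H1 e12) subrr.
  by rewrite subr0.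
Qed.

(** Over the union of the cells the integral equals the sum, by induction on their number; the
    inequality comes from enlarging the domain, as the cells may leave part of []0, tau]]
    uncovered. *)
Lemma step_fun_sqr_integral_ge (tau : R) (g : seq (R * (R * R)))
    (n : nat) (t c : nat -> R) :
  0 <= t 0%N -> t n <= tau -> (forall k, (k < n)%N -> t k <= t k.+1) ->
  (forall k, (k < n)%N -> forall s, t k < s <= t k.+1 -> step_fun g s = c k) ->
  ((\sum_(k < n) c k ^+ 2 * (t k.+1 - t k))%:E <=
   \int[mu]_(s in `]0%R, tau]) (step_fun g s ^+ 2)%:E)%E.
Proof.
move=> t0 tn ndt gc.
have mf (D : set R) : measurable_fun D (fun s => (step_fun g s ^+ 2)%:E).
  by apply/measurable_EFinP; apply: measurable_funX; exact: measurable_step_fun.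
have H m : (m <= n)%N -> t 0%N <= t m /\
  (\int[mu]_(s in `]t 0%N, t m]) (step_fun g s ^+ 2)%:E =
   (\sum_(k < m) c k ^+ 2 * (t k.+1 - t k))%:E)%E.
  elim: m => [_|m IH mn].
    by rewrite set_itv_ge ?bnd_simp ?ltxx// integral_set0 big_ord0.
  have [tm IHm] := IH (ltnW mn); have tmm := ndt _ mn.
  split; first exact: le_trans tmm.
  rewrite (_ : `]t 0%N, t m.+1]%classic = `]t 0%N, t m] `|` `]t m, t m.+1]);
    last first.
    by rewrite -itv_bndbnd_setU// bnd_simp.
  rewrite ge0_integral_setU//=; last 3 first.
  - exact: mf.
  - by move=> s _; rewrite lee_fin sqr_ge0.
  - rewrite disj_set2E; apply/eqP/seteqP; split => // s /= [].
    by rewrite !in_itv/= => /andP[_ +] /andP[+ _]; rewrite leNgt => /negbTE ->.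
  rewrite IHm big_ord_recr/= EFinD; congr (_ + _)%E.
  transitivity (\int[mu]_(s in `]t m, t m.+1]) (cst (c m ^+ 2)%:E s))%E.
    by apply: eq_integral => s; rewrite inE/= in_itv/= => /(gc _ mn) ->.
  rewrite integral_cst//= lebesgue_measure_itv/= lte_fin EFinM.
  have [tt|tt] := ltP (t m) (t m.+1); first by rewrite -EFinB.
  have -> : t m.+1 = t m by apply/eqP; rewrite eq_le tt.
  by rewrite subrr mulr0 mule0.
have [t0n <-] := H n (leqnn n).
apply: ge0_subset_integral => //.
- exact: mf.
- by move=> s _; rewrite lee_fin sqr_ge0.
- move=> s/=; rewrite !in_itv/= => /andP[ts st].
  by rewrite (le_lt_trans t0 ts) (le_trans st tn).
Qed.

End step_functions.

(** * Exponential moments of Wiener integrals *)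

Section wiener_exponentials.
Context {R : realType} {dp : measure_display} {Omega : measurableType dp}.
Notation mu := (@lebesgue_measure R).
Variables (P : probability Omega R) (T : R) (W : R -> Omega -> R).
Hypothesis bmW : brownian_motion P T W.
Variable tau : R.
Hypothesis tau0T : 0 <= tau <= T.

Lemma measurable_step_integral (g : seq (R * (R * R))) : steps_in tau g ->
  measurable_fun setT (step_integral W g).
Proof.
case: bmW => mW _ _ _ _; move: tau0T => /andP[tau0 tauT].
rewrite /step_integral; elim: g => [_|e g IH /andP[/andP[e0 /andP[e12 e2]] gin]].
  by under eq_fun do rewrite big_nil; exact: measurable_cst.
under eq_fun do rewrite big_cons; apply: measurable_funD; last exact: IH.
apply: measurable_funM => //; apply: measurable_funB; apply: mW.
  by rewrite (le_trans e0 e12) (le_trans e2).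
by rewrite e0 (le_trans e12) ?(le_trans e2).
Qed.

Lemma step_integral_exp_sqr (g : seq (R * (R * R))) (V lam : R) :
  steps_in tau g ->
  (\int[mu]_(s in `]0%R, tau]) (step_fun g s ^+ 2)%:E <= V%:E)%E ->
  0 < lam -> 4 * lam * V <= 1 ->
  (\int[P]_w (expR (lam * step_integral W g w ^+ 2))%:E <= (Num.sqrt 2)%:E)%E.
Proof.
move: tau0T => /andP[tau0 tauT] gin gV lam0 lamV.
have [n [t [c [t0 tn ndt gc SE]]]] := step_fun_partition _ _ tau0 gin.
have VE := step_fun_sqr_integral_ge _ _ _ _ _ t0 tn ndt gc.
under eq_integral do rewrite SE.
apply: (brownian_sum_exp_sqr P T W bmW n t c t0 (le_trans tn tauT) ndt lam lam0).
apply: le_trans lamV; rewrite ler_wpM2l ?mulr_ge0 ?(ltW lam0)//.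
by rewrite -lee_fin (le_trans VE).
Qed.

(** Step functions close to [f] have squared norm at most [2 * M + 1], and the step bound is applied
    to them with [2 * lam], whence the factor 8. The L^2 convergence is used on exponentials
    truncated at [N], and the truncation is removed last. *)
Lemma wiener_integral_exp_sqr (f : R -> R) (X : Omega -> R) (M lam : R) :
  measurable_fun `]0, tau] f ->
  (\int[mu]_(s in `]0%R, tau]) (f s ^+ 2)%:E <= M%:E)%E ->
  wiener_integral P W tau f X -> 0 < lam -> 8 * lam * (2 * M + 1) <= 1 ->
  (\int[P]_w (expR (lam * X w ^+ 2))%:E <= (expR 1 * Num.sqrt 2)%:E)%E.
Proof.
move=> mf fM [mX [g [gin gf gX]]] lam0 lamM.
have M0 : 0 <= M.
  rewrite -lee_fin; apply: le_trans fM; apply: integral_ge0 => s _.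
  by rewrite lee_fin sqr_ge0.
(* This absorbs the error [2 * lam] in the exponent into the factor [expR 1]. *)
have lam1 : 2 * lam <= 1 by nra.
have mexp (Z : Omega -> R) (a : R) : measurable_fun setT Z ->
    measurable_fun setT (fun w => expR (a * Z w ^+ 2)).
  move=> mZ; apply: measurableT_comp => //; apply: measurable_funM => //.
  exact: measurable_funX.
have trunc (N : nat) : (\int[P]_w (Num.min (expR (lam * X w ^+ 2)) N%:R)%:E
    <= (expR 1 * Num.sqrt 2)%:E)%E.
  apply/lee_addgt0Pr => e e0.
  have near_lt (u : nat -> \bar R) (r : R) : 0 < r -> u @ \oo --> 0%E ->
      \forall n \near \oo, (u n < r%:E)%E.
    move=> r0 u0; apply: (u0 [set y | (y < r%:E)%E]).
    by apply: open_ereal_lt'; rewrite lte_fin.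
  have half0 : (0 : R) < 2^-1 by [].
  have H1 := near_lt _ _ half0 gf.
  (* Multiplied by [N] this stays at most [e], and [N = 0] causes no division by zero. *)
  have eN : 0 < e / N.+1%:R by rewrite divr_gt0.
  have H2 := near_lt _ _ eN gX.
  have [n [gfn gXn]] : exists n,
    ((\int[mu]_(s in `[0%R, tau]) ((f s - step_fun (g n) s) ^+ 2)%:E) <
      (2^-1)%:E)%E /\
    ((\int[P]_w ((X w - step_integral W (g n) w) ^+ 2)%:E) < (e / N.+1%:R)%:E)%E.
    by have [n _ /(_ n (leqnn n))] := filterI H1 H2; exists n.
  pose S := step_integral W (g n).
  have mS : measurable_fun setT S by exact: measurable_step_integral.
  (* The step function is [f - r] with [r] of squared norm at most 1/2, and its square is at most
     twice the sum of the two squares. *)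
  have varS : (\int[mu]_(s in `]0%R, tau]) (step_fun (g n) s ^+ 2)%:E
      <= (2 * M + 1)%:E)%E.
    pose r s := f s - step_fun (g n) s.
    have mr : measurable_fun `]0, tau] r.
      by apply: measurable_funB => //; exact: measurable_step_fun.
    have rn : (\int[mu]_(s in `]0%R, tau]) (r s ^+ 2)%:E <= (2^-1)%:E)%E.
      by rewrite integral_itv_obnd_cbnd ?ltW//;
        apply/measurable_EFinP/measurable_funX.
    apply: (@le_trans _ _ (\int[mu]_(s in `]0%R, tau])
        (2%:E * (f s ^+ 2)%:E + 2%:E * (r s ^+ 2)%:E))%E).
      apply: ge0_le_integral => //.
      - by move=> s _; rewrite lee_fin sqr_ge0.
      - apply/measurable_EFinP/measurable_funX; exact: measurable_step_fun.
      - by apply: emeasurable_funD; apply: measurable_funeM; apply/measurable_EFinP;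
          exact: measurable_funX.
      - move=> s _; rewrite -!EFinM -EFinD lee_fin -subr_ge0.
        have -> : 2 * f s ^+ 2 + 2 * r s ^+ 2 - step_fun (g n) s ^+ 2 =
            (f s + r s) ^+ 2 by rewrite /r; ring.
        exact: sqr_ge0.
    rewrite ge0_integralD//; last 4 first.
    - by move=> s _; rewrite mule_ge0 ?lee_fin ?sqr_ge0.
    - by apply: measurable_funeM; apply/measurable_EFinP; exact: measurable_funX.
    - by move=> s _; rewrite mule_ge0 ?lee_fin ?sqr_ge0.
    - by apply: measurable_funeM; apply/measurable_EFinP; exact: measurable_funX.
    rewrite !ge0_integralZl//; last 4 first.
    - by apply/measurable_EFinP; exact: measurable_funX.
    - by move=> s _; rewrite lee_fin sqr_ge0.
    - by apply/measurable_EFinP; exact: measurable_funX.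
    - by move=> s _; rewrite lee_fin sqr_ge0.
    have -> : (2 * M + 1)%:E = (2%:E * M%:E + 2%:E * (2^-1)%:E)%E.
      by rewrite -!EFinM -EFinD divff.
    by rewrite leeD// lee_wpmul2l.
  have expS : (\int[P]_w (expR (2 * lam * S w ^+ 2))%:E <= (Num.sqrt 2)%:E)%E.
    apply: (step_integral_exp_sqr _ (2 * M + 1)) => //.
      by rewrite mulr_gt0.
    by rewrite !mulrA; lra.
  apply: (@le_trans _ _ (\int[P]_w ((expR 1)%:E * (expR (2 * lam * S w ^+ 2))%:E
      + N%:R%:E * ((X w - S w) ^+ 2)%:E))%E).
    apply: ge0_le_integral => //.
    - apply/measurable_EFinP; apply: measurable_minr => //; exact: mexp.
    - apply: emeasurable_funD; apply: measurable_funeM; apply/measurable_EFinP.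
        exact: mexp.
      by apply: measurable_funX; exact: measurable_funB.
    - move=> w _; rewrite -!EFinM -EFinD lee_fin ge_min.
      (* If [S] is close to [X] the exponents are compared; otherwise the truncated value is at most
         [N], hence at most [N] times the squared distance. *)
      have [d1|d1] := leP ((X w - S w) ^+ 2) 1.
        apply/orP; left; rewrite -expRD -[leLHS]addr0.
        apply: lerD; last by rewrite mulr_ge0// sqr_ge0.
        rewrite ler_expR.
        have XS : X w ^+ 2 <= 2 * S w ^+ 2 + 2 * (X w - S w) ^+ 2.
          rewrite -subr_ge0.
          have -> : 2 * S w ^+ 2 + 2 * (X w - S w) ^+ 2 - X w ^+ 2 =
             (X w - 2 * S w) ^+ 2 by ring.
          exact: sqr_ge0.
        have : lam * X w ^+ 2 <= lam * (2 * S w ^+ 2 + 2).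
          by rewrite ler_wpM2l ?(ltW lam0)//; lra.
        lra.
      apply/orP; right; rewrite -[leLHS]add0r.
      apply: lerD; first by rewrite mulr_ge0// expR_ge0.
      by rewrite ler_peMr// ltW.
  rewrite ge0_integralD//; last 3 first.
  - by apply: measurable_funeM; apply/measurable_EFinP; exact: mexp.
  - by move=> w _; rewrite mule_ge0 ?lee_fin ?sqr_ge0.
  - apply: measurable_funeM; apply/measurable_EFinP.
    by apply: measurable_funX; exact: measurable_funB.
  rewrite !ge0_integralZl//; last 3 first.
  - apply/measurable_EFinP.
    by apply: measurable_funX; exact: measurable_funB.
  - by move=> w _; rewrite lee_fin sqr_ge0.
  - by apply/measurable_EFinP; exact: mexp.
  rewrite EFinM leeD//; first by rewrite lee_wpmul2l// lee_fin expR_ge0.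
  apply: (@le_trans _ _ (N%:R%:E * (e / N.+1%:R)%:E)%E).
    by rewrite lee_wpmul2l// ltW.
  rewrite -EFinM lee_fin mulrCA ler_piMr ?ltW//.
  by rewrite ltr_pdivrMr// mul1r ltr_nat.
(* For each [w] the truncations increase and are eventually equal to the exponential, so monotone
   convergence removes them. *)
pose h N w := (Num.min (expR (lam * X w ^+ 2)) N%:R)%:E.
have -> : (\int[P]_w (expR (lam * X w ^+ 2))%:E = \int[P]_w limn (h ^~ w))%E.
  apply: eq_integral => w _; apply/esym/cvg_lim => //.
  apply: cvg_near_cst; near=> N; rewrite /h min_l//.
  near: N; exact: nbhs_infty_ger.
have mh N : measurable_fun setT (h N).
  by apply/measurable_EFinP; apply: measurable_minr => //; exact: mexp.
have h0 N w : (0 <= h N w)%E by rewrite lee_fin le_min expR_ge0 ler0n.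
have ndh w : {homo h ^~ w : a b / (a <= b)%N >-> (a <= b)%E}.
  move=> a b ab; rewrite lee_fin le_min !ge_min lexx/= ler_nat ab orbT.
  by [].
rewrite monotone_convergence//.
apply: lime_le.
  apply: ereal_nondecreasing_is_cvgn => a b ab; apply: ge0_le_integral => //.
  by move=> w _; exact: ndh.
by apply: nearW => N; exact: trunc.
Unshelve. all: by end_near.
Qed.

End wiener_exponentials.

(** * A variance bound uniform in time *)

Section kernel_bound.
Context {R : realType}.
Notation mu := (@lebesgue_measure R).

(* Taking [s = 0] and [tau = T] in Assumption F, as [K 0] vanishes on (0, T]. *)
Lemma kernel_sqr_bound (T : R) (K : R -> R -> R) : 0 < T ->
  admissible_kernel T K -> assumptionF T K ->
  exists2 M : R, 0 <= M & forall t, 0 <= t <= T ->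
    measurable_fun `]0, t] (K t) /\
    (\int[mu]_(s in `]0%R, t]) (K t s ^+ 2)%:E <= M%:E)%E.
Proof.
move=> T0 [_ Ksq _ Kvol] [eta [_ _ etaP]].
have mKT t : 0 <= t <= T -> measurable_fun `[0, T] (K t).
  move=> /andP[t0 tT]; move: t0; rewrite le_eqVlt => /orP[/eqP <-|t0]; last first.
    by case: (Ksq t); rewrite ?t0.
  (* Admissibility gives square-integrable slices for [t > 0] only; the slice at 0 vanishes at
     positive times, so on [[0, T]] it is a multiple of the indicator of the point 0. *)
  apply: (@eq_measurable_fun _ _ _ _ _ (fun s => K 0 0 * \1_[set (0 : R)] s)).
    move=> s; rewrite inE/= in_itv/= => /andP[s0 sT]; rewrite indicE.
    have [->|sn0] := eqVneq s 0; first by rewrite mem_set// mulr1.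
    rewrite memNset ?mulr0; last exact/eqP.
    by rewrite Kvol ?lexx ?s0// ?ltW// lt_neqAle eq_sym sn0.
  by apply: measurable_funM => //; exact: measurable_indic.
exists (eta T ^+ 2); first exact: sqr_ge0.
move=> t tT; have /andP[t0 tleT] := tT.
have sub : `]0, t]%classic `<=` `[0, T]%classic.
  by move=> s/=; rewrite !in_itv/= => /andP[/ltW -> st]; exact: le_trans tleT.
split; first by apply: measurable_funS (mKT _ tT).
have TT : 0 <= T <= T by rewrite lexx ltW.
have T00 : 0 <= (0 : R) <= T by rewrite lexx ltW.
apply: le_trans (etaP T TT); apply: (@le_trans _ _
  (\int[mu]_(u in `[0%R, T]) ((K t u - K 0 u) ^+ 2)%:E)%E); last first.
  apply: ereal_sup_ubound; exists t, 0; split => //.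
  by rewrite subr0 ger0_norm.
(* The end point 0 is left out, as [K 0 0] may be nonzero. *)
apply: (@le_trans _ _ (\int[mu]_(u in `]0%R, t]) ((K t u - K 0 u) ^+ 2)%:E)%E).
  rewrite le_eqVlt; apply/orP; left; apply/eqP; apply: eq_integral => s.
  rewrite inE/= in_itv/= => /andP[s0 st].
  by rewrite (Kvol 0 s) ?subr0// ltW//= (le_trans st).
apply: ge0_subset_integral => //.
  apply/measurable_EFinP/measurable_funX/measurable_funB; exact: mKT.
by move=> s _; rewrite lee_fin sqr_ge0.
Qed.

End kernel_bound.

(** * Jensen's inequality in time *)

Section jensen.
Context {R : realType}.
Notation mu := (@lebesgue_measure R).

(** The exponential lies above its tangent at [a], the mean of [b * T * h] over [[0, T]]; after
    integration the linear terms cancel. The integral of [h] may be infinite, hence [expeR]. *)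
Lemma expeR_integral_le (T b : R) (h : R -> R) : 0 < T -> 0 < b ->
  measurable_fun `[0, T] h -> (forall s, 0 <= h s) ->
  (expeR (b%:E * \int[mu]_(s in `[0%R, T]) (h s)%:E) <=
   T^-1%:E * \int[mu]_(s in `[0%R, T]) (expR (b * T * h s))%:E)%E.
Proof.
move=> T0 b0 mh h0.
have mexp : measurable_fun `[0, T] (fun s => (expR (b * T * h s))%:E).
  by apply/measurable_EFinP; apply: measurableT_comp => //; exact: measurable_funM.
have mhE : measurable_fun `[0, T] (fun s => (h s)%:E) by exact/measurable_EFinP.
have muT : mu `[0, T]%classic = T%:E.
  by rewrite lebesgue_measure_itv/= lte_fin T0 oppr0 adde0.
have bT0 : 0 <= b * T by rewrite mulr_ge0// ltW.
have Vge0 : (0 <= T^-1%:E :> \bar R)%E by rewrite lee_fin invr_ge0 ltW.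
have I0 : (0 <= \int[mu]_(s in `[0%R, T]) (h s)%:E)%E.
  by apply: integral_ge0 => s _; rewrite lee_fin.
set I := (\int[mu]_(s in `[0%R, T]) (h s)%:E)%E in I0 *.
have intZ c : 0 <= c -> (\int[mu]_(s in `[0%R, T]) (c%:E * (h s)%:E) = c%:E * I)%E.
  by move=> c0; rewrite ge0_integralZl// => s _; rewrite lee_fin.
(* If the integral is infinite, so is the right side, because [expR y >= y]. *)
case IE : I I0 => [r| |]// I0; last first.
  suff -> : (\int[mu]_(s in `[0%R, T]) (expR (b * T * h s))%:E = +oo)%E.
    by rewrite [leRHS]gt0_muley ?lte_fin ?invr_gt0// leey.
  apply/eqP; rewrite -leye_eq.
  apply: (@le_trans _ _ (\int[mu]_(s in `[0%R, T]) ((b * T)%:E * (h s)%:E))%E).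
    by rewrite intZ// IE gt0_muley// lte_fin mulr_gt0.
  apply: ge0_le_integral => //.
  - by move=> s _; rewrite mule_ge0 ?lee_fin.
  - exact: measurable_funeM.
  - move=> s _; rewrite -EFinM lee_fin; apply: le_trans (expR_ge1Dx _).
    by rewrite lerDr.
have r0 : 0 <= r by rewrite -lee_fin.
rewrite -EFinM/=; pose a := b * r.
have a0 : 0 <= a by rewrite mulr_ge0// ltW.
have c0 : 0 <= expR a * (b * T) by rewrite mulr_ge0// expR_ge0.
(* The tangent inequality, with the negative term moved across so that both integrands are
   nonnegative. *)
have H : (\int[mu]_(s in `[0%R, T])
    ((expR a)%:E + (expR a * (b * T))%:E * (h s)%:E) <=
  \int[mu]_(s in `[0%R, T]) ((expR (b * T * h s))%:E + (expR a * a)%:E))%E.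
  apply: ge0_le_integral => //.
  - by move=> s _; rewrite adde_ge0 ?mule_ge0 ?lee_fin ?mulr_ge0 ?expR_ge0 ?h0 ?ltW.
  - by apply: emeasurable_funD => //; exact: measurable_funeM.
  - by apply: emeasurable_funD.
  - move=> s _; rewrite -EFinM -!EFinD lee_fin.
    have -> : expR (b * T * h s) = expR a * expR (b * T * h s - a).
      by rewrite -expRD; congr expR; ring.
    have := ler_wpM2l (expR_ge0 a) (expR_ge1Dx (b * T * h s - a)); lra.
rewrite ge0_integralD//= in H; last 2 first.
- by move=> s _; rewrite mule_ge0 ?lee_fin ?mulr_ge0 ?expR_ge0 ?h0 ?ltW.
- exact: measurable_funeM.
rewrite ge0_integralD//= in H; last first.
- by move=> s _; rewrite lee_fin mulr_ge0.
rewrite (intZ _ c0) IE !integral_cst//= !muT in H.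
have E1 : ((expR a * (b * T))%:E * r%:E = (expR a * a)%:E * T%:E)%E.
  by rewrite -!EFinM /a; congr EFin; ring.
rewrite E1 leeD2rE// in H.
have -> : (expR a)%:E = (T^-1%:E * ((expR a)%:E * T%:E))%E.
  by rewrite -!EFinM mulrC mulfK// gt_eqF.
by rewrite lee_wpmul2l.
Qed.

End jensen.

(** * The exponential moment of the model at a fixed time *)

(** If [p] is the index of an entry of largest absolute value, the sum of squares is at most
    [d%:R * m%:R ^+ 2] times the square of that entry, and the resulting exponential is one of the
    terms on the right. *)
Lemma expR_sum_sqr_le (R : realType) (d m : nat) (u : 'I_d -> 'I_m -> R) (c : R) :
  (0 < d)%N -> (0 < m)%N -> 0 <= c ->
  expR (c * \sum_(i < d) (\sum_(j < m) u i j) ^+ 2) <=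
  \sum_(p : 'I_d * 'I_m) expR (c * d%:R * m%:R ^+ 2 * u p.1 p.2 ^+ 2).
Proof.
move=> d0 m0 c0.
pose p0 : 'I_d * 'I_m := (Ordinal d0, Ordinal m0).
pose p := [arg max_(q > p0) `|u q.1 q.2|]%O.
have pmax q : `|u q.1 q.2| <= `|u p.1 p.2|.
  rewrite /p.
  by case: (@arg_maxP _ _ _ p0 xpredT (fun q => `|u q.1 q.2|)) => // r _; apply.
apply: (@le_trans _ _ (expR (c * d%:R * m%:R ^+ 2 * u p.1 p.2 ^+ 2))).
  have -> : c * d%:R * m%:R ^+ 2 * u p.1 p.2 ^+ 2 =
    c * (d%:R * (m%:R ^+ 2 * u p.1 p.2 ^+ 2)) by ring.
  rewrite ler_expR ler_wpM2l//.
  apply: (@le_trans _ _ (\sum_(i < d) (m%:R ^+ 2 * u p.1 p.2 ^+ 2))); last first.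
    by rewrite sumr_const card_ord mulr_natl.
  apply: ler_sum => i _; rewrite -exprMn -real_normK ?num_real//.
  rewrite -[leRHS]real_normK ?num_real// ler_sqr ?nnegrE//.
  apply: (le_trans (ler_norm_sum _ _ _)); rewrite normrM ger0_norm//.
  apply: (@le_trans _ _ (\sum_(j < m) `|u p.1 p.2|)).
    by apply: ler_sum => j _; exact: (pmax (i, j)).
  by rewrite sumr_const card_ord mulr_natl.
by rewrite (bigD1 p)//= lerDl; apply: sumr_ge0 => q _; exact: expR_ge0.
Qed.

Lemma sqr_enormE (R : realType) (d : nat) (v : 'rV[R]_d) :
  enorm v ^+ 2 = \sum_(i < d) v ord0 i ^+ 2.
Proof. by rewrite sqr_sqrtr// sumr_ge0// => i _; rewrite sqr_ge0. Qed.

Section fixed_time.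
Context (R : realType) (dp : measure_display) (Omega : measurableType dp).
Notation mu := (@lebesgue_measure R).
Variables (P : probability Omega R) (T : R) (d m : nat).
Hypotheses (d0 : (0 < d)%N) (m0 : (0 < m)%N).
Variables (K : 'I_d -> 'I_m -> R -> R -> R) (x : 'rV[R]_d).
Variables (B : 'I_m -> R -> Omega -> R) (eps : R) (Y : R -> Omega -> 'rV[R]_d).
Hypothesis bmB : forall j, brownian_motion P T (B j).
Hypothesis eps0 : 0 < eps.
Hypothesis modelY : gaussian_model P T K x B eps Y.

(** The square of a sum is at most twice the sum of the squares, which separates [x] from the
    integrals; splitting these into single ones gives the coefficient [lam]. The condition on [eps]
    is [8 * lam * (2 * M + 1) <= 1], and [eps] enters only through [lam], so the bound is free of
    it. *)
Lemma gaussian_model_exp_sqr (t M a : R) : 0 <= t <= T ->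
  (forall i j, measurable_fun `]0, t] (K i j t) /\
    (\int[mu]_(s in `]0%R, t]) (K i j t s ^+ 2)%:E <= M%:E)%E) ->
  0 < a -> eps * (16 * a * d%:R * m%:R ^+ 2 * (2 * M + 1)) <= 1 ->
  (\int[P]_w (expR (a * enorm (Y t w) ^+ 2))%:E <=
   (expR (2 * a * enorm x ^+ 2) * ((d * m)%:R * (expR 1 * Num.sqrt 2)))%:E)%E.
Proof.
move=> tT KM a0 epsM; case: modelY => mY /(_ t _ tT) YX.
have {YX} /choice[X YX] := YX.
pose lam := 2 * a * eps * d%:R * m%:R ^+ 2.
have lam0 : 0 < lam by rewrite !mulr_gt0 ?exprn_gt0 ?ltr0n.
have XE i j : (\int[P]_w (expR (lam * X i j w ^+ 2))%:E <=
    (expR 1 * Num.sqrt 2)%:E)%E.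
  have [mK KM'] := KM i j.
  apply: (wiener_integral_exp_sqr P T (B j) (bmB j) t tT (K i j t)
    (X i j) M lam) => //.
    by case: (YX i).
  by apply: le_trans epsM; rewrite /lam le_eqVlt; apply/orP; left; apply/eqP; ring.
have mX i j : measurable_fun setT (X i j) by case: (YX i) => /(_ j)[].
have mXe i j : measurable_fun setT (fun w => (expR (lam * X i j w ^+ 2))%:E).
  apply/measurable_EFinP; apply: measurableT_comp => //.
  by apply: measurable_funM => //; exact: measurable_funX.
have mYt i : measurable_fun setT (fun w => Y t w ord0 i).
  pose p2 (w : Omega) : measurableTypeR R * Omega := (t, w).
  apply: (@measurable_comp _ _ _ _ _ _ (`[0, T] `*` setT)
    (fun p : measurableTypeR R * Omega => Y p.1 p.2 ord0 i) setT p2) => //.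
  - exact: measurableX.
  - by move=> _ [w _ <-]; split => //=; rewrite in_itv.
  - exact: measurable_pair1.
have mYn : measurable_fun setT (fun w => enorm (Y t w) ^+ 2).
  under eq_fun do rewrite sqr_enormE.
  by apply: measurable_sum => i; exact: measurable_funX.
have aeY : {ae P, forall w, forall i,
    Y t w ord0 i = x ord0 i + Num.sqrt eps * \sum_(j < m) X i j w}.
  by apply: filter_forall => i; case: (YX i).
apply: (@le_trans _ _ (\int[P]_w ((expR (2 * a * enorm x ^+ 2))%:E *
    \sum_(p : 'I_d * 'I_m) (expR (lam * X p.1 p.2 w ^+ 2))%:E))%E).
  apply: ae_ge0_le_integral => //.
  - apply/measurable_EFinP; apply: measurableT_comp => //.
    exact: measurable_funM.
  - by move=> w _; rewrite mule_ge0// sume_ge0.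
  - by apply: measurable_funeM; apply: emeasurable_sum.
  - apply: filterS aeY => w Yw _.
    rewrite sumEFin -EFinM lee_fin.
    have cge0 : 0 <= 2 * a * eps by rewrite !mulr_ge0// ltW.
    apply: le_trans (ler_wpM2l (expR_ge0 _)
      (expR_sum_sqr_le R d m (fun i j => X i j w) _ d0 m0 cge0)).
    rewrite -expRD ler_expR !sqr_enormE !mulr_sumr -big_split/=.
    apply: ler_sum => i _; rewrite Yw -subr_ge0.
    set S := \sum_(j < m) _.
    have := sqr_sqrtr (ltW eps0); set r := Num.sqrt eps => <-.
    have -> : 2 * a * x ord0 i ^+ 2 + 2 * a * r ^+ 2 * S ^+ 2 -
      a * (x ord0 i + r * S) ^+ 2 = a * (x ord0 i - r * S) ^+ 2 by ring.
    by rewrite mulr_ge0 ?sqr_ge0// ltW.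
rewrite ge0_integralZl//; last 2 first.
- by apply: emeasurable_sum.
- by move=> w _; rewrite sume_ge0.
rewrite ge0_integral_sum// EFinM lee_wpmul2l//.
apply: (@le_trans _ _ (\sum_(p : 'I_d * 'I_m) (expR 1 * Num.sqrt 2)%:E)%E).
  by apply: lee_sum.
by rewrite sumEFin sumr_const card_prod !card_ord mulr_natl.
Qed.

End fixed_time.

(** * The exponential moment of the time integral *)

Theorem lemma8p29 (R : realType) (T : R) (hT : 0 < T) (d m : nat)
    (hd : (0 < d)%N) (hm : (0 < m)%N)
    (K : 'I_d -> 'I_m -> R -> R -> R)
    (hK : forall i j, admissible_kernel T (K i j))
    (hF : forall i j, assumptionF T (K i j))
    (x : 'rV[R]_d) :
  forall beta : R, 0 < beta ->
  exists2 eps1 : R, 0 < eps1 <= 1 &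
  exists2 L : R, 0 < L &
  forall (dp : measure_display) (Omega : measurableType dp)
    (P : probability Omega R) (B : 'I_m -> R -> Omega -> R),
  multi_brownian_motion P T B ->
  forall eps : R, 0 < eps < eps1 ->
  forall Y : R -> Omega -> 'rV[R]_d, gaussian_model P T K x B eps Y ->
  (\int[P]_w expeR (beta%:E *
     \int[@lebesgue_measure R]_(s in `[0%R, T]) (enorm (Y s w) ^+ 2)%:E)
   <= L%:E)%E.
Proof.
move=> beta beta0.
have /choice[Mb MbP] : forall p : 'I_d * 'I_m, exists M : R, 0 <= M /\
    forall t, 0 <= t <= T -> measurable_fun `]0, t] (K p.1 p.2 t) /\
    (\int[@lebesgue_measure R]_(s in `]0%R, t]) (K p.1 p.2 t s ^+ 2)%:E <= M%:E)%E.
  move=> p.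
  by have [M] := kernel_sqr_bound T _ hT (hK p.1 p.2) (hF p.1 p.2); exists M.
(* A sum of nonnegative bounds serves all the kernels at once. *)
pose M := \sum_p Mb p.
have M0 : 0 <= M by apply: sumr_ge0 => p _; case: (MbP p).
have KM t : 0 <= t <= T -> forall i j, measurable_fun `]0, t] (K i j t) /\
    (\int[@lebesgue_measure R]_(s in `]0%R, t]) (K i j t s ^+ 2)%:E <= M%:E)%E.
  move=> tT i j; have [_ /(_ t tT) [mK KMb]] := MbP (i, j); split => //.
  apply: (le_trans KMb); rewrite lee_fin /M (bigD1 (i, j))//= lerDl.
  by apply: sumr_ge0 => p _; case: (MbP p).
(* Jensen on [[0, T]] turns the factor [beta] into [beta * T]. *)
pose a := beta * T; have a0 : 0 < a by rewrite mulr_gt0.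
pose D := 16 * a * d%:R * m%:R ^+ 2 * (2 * M + 1).
have D0 : 0 < D.
  rewrite !mulr_gt0 ?exprn_gt0 ?ltr0n//.
  by rewrite ltr_wpDl// mulr_ge0.
pose L := expR (2 * a * enorm x ^+ 2) * ((d * m)%:R * (expR 1 * Num.sqrt 2)).
have L0 : 0 < L.
  by rewrite !mulr_gt0 ?expR_gt0 ?ltr0n ?muln_gt0 ?hd ?hm ?sqrtr_gt0.
(* Below [D^-1] the smallness condition of the fixed-time bound holds. Both constants are chosen
   before the probability space and [eps]. *)
exists (Num.min 1 D^-1); first by rewrite lt_min ltr01 invr_gt0 D0 ge_min lexx.
exists L => // dp Omega P B [bmB _] eps /andP[eps0].
rewrite lt_min => /andP[_ epsD] Y modelY.
have epsD1 : eps * D <= 1 by rewrite -ler_pdivlMr// mul1r ltW.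
have fixed t : 0 <= t <= T ->
    (\int[P]_w (expR (a * enorm (Y t w) ^+ 2))%:E <= L%:E)%E.
  move=> tT.
  exact: (gaussian_model_exp_sqr R dp Omega P T d m hd hm K x B eps Y
    bmB eps0 modelY t M a tT (KM t tT) a0 epsD1).
pose DT : set (measurableTypeR R * Omega) := `[0, T]%classic `*` setT.
have mDT : measurable DT by exact: measurableX.
pose N (p : measurableTypeR R * Omega) := enorm (Y p.1 p.2) ^+ 2.
have mN : measurable_fun DT N.
  have [mY _] := modelY.
  rewrite /N; under eq_fun do rewrite sqr_enormE.
  by apply: measurable_sum => i; apply: measurable_funX; exact: mY.
(* Extended by 0 outside [[0, T]], so that Tonelli applies on the whole product space. *)
pose F := (fun p => (expR (a * N p))%:E) \_ DT.
have mF : measurable_fun setT F.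
  apply/(measurable_restrictT _ mDT)/measurable_EFinP.
  by apply: measurableT_comp => //; exact: measurable_funM.
have F0 p : (0 <= F p)%E by rewrite /F patchE; case: ifP.
have FE s w : F (s, w) =
    ((fun s => (expR (a * enorm (Y s w) ^+ 2))%:E) \_ `[0, T]%classic) s.
  rewrite /F !patchE; congr (if _ then _ else _).
  by apply/idP/idP; rewrite !inE/=; [case|split].
have V0 : (0 <= T^-1%:E :> \bar R)%E by rewrite lee_fin invr_ge0 ltW.
apply: (@le_trans _ _ (\int[P]_w (T^-1%:E * \int[@lebesgue_measure R]_s F (s, w)))%E).
  apply: ge0_le_integral_setT => w; first exact: expeR_ge0.
  pose ps (s : measurableTypeR R) : measurableTypeR R * Omega := (s, w).
  have mNw : measurable_fun `[0, T] (fun s => N (s, w)).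
    apply: (@measurable_comp _ _ _ _ _ _ DT N `[0, T]%classic ps) => //.
    - by move=> _ [s sT <-]; split.
    - by apply: measurable_funTS; exact: measurable_pair2.
  apply: le_trans (expeR_integral_le T beta _ hT beta0 mNw _) _.
    by move=> s; exact: sqr_ge0.
  rewrite [in leLHS]integral_mkcond.
  by under [in leRHS]eq_integral do rewrite FE.
rewrite ge0_integralZl//; last 2 first.
- exact: (measurable_fun_fubini_tonelli_G).
- by move=> w _; apply: integral_ge0 => s _; exact: F0.
rewrite -(@fubini_tonelli _ _ (measurableTypeR R) Omega R (@lebesgue_measure R) P F)//.
(* The inner expectation is at most [L] for times in [[0, T]] and 0 outside, so the time average is
   at most [L]. *)
apply: (@le_trans _ _ (T^-1%:E * \int[@lebesgue_measure R]_(s in `[0%R, T]) L%:E)%E).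
  rewrite lee_wpmul2l//.
  rewrite [leRHS]integral_mkcond; apply: ge0_le_integral => //.
  - by move=> s _; apply: integral_ge0 => w _; exact: F0.
  - exact: measurable_fun_fubini_tonelli_F.
  - apply: (measurable_restrictT _ _).1 => //; exact: measurable_cst.
  - move=> s _; rewrite patchE; case: ifPn => sT.
      apply: le_trans (fixed s _); last by move: sT; rewrite inE/= in_itv.
      by under eq_integral do rewrite FE patchE sT.
    by rewrite integral0_eq// => w _; rewrite FE patchE (negbTE sT).
rewrite integral_cst//= lebesgue_measure_itv/= lte_fin hT oppr0 adde0.
by rewrite -!EFinM lee_fin mulrC mulfK// gt_eqF.
Qed.
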